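(* Let $d\ge 2$, let $\mathcal X\in\mathbb R^{n_1\times\cdots\times n_d}$ be a nonzero tensor, and let $B$ be a storage budget such that the feasible set $\{\mathbf r\in\mathcal R : S(\mathbf r)\le B\}$ is nonempty. Let $k\in\{1,\ldots,d\}$ with $n_k\ge 2$. If $$L_k(n_k-1)^2>\Gamma_k(B),$$ then every global minimiser $\mathbf r^\star$ of $$\min_{\mathbf r\in\mathcal R} f(\mathbf r)\quad\text{subject to}\quad S(\mathbf r)\le B$$ satisfies $r_k^\star=n_k$. (The condition depends on $B$ and cannot hold when $\Gamma_k(B)=\infty$.)
   Context: For $\mathcal X\in\mathbb R^{n_1\times\cdots\times n_d}$, the mode-$k$ unfolding $X_{(k)}\in\mathbb R^{n_k\times\prod_{j\ne k}n_j}$ is the matrix obtained by reshaping $\mathcal X$ so that mode $k$ indexes the rows and all remaining modes are collapsed into the columns. Its singular values are $\sigma_1(X_{(k)})\ge\cdots\ge\sigma_{n_k}(X_{(k)})\ge 0$ (the square roots of the $n_k$ eigenvalues of $X_{(k)}X_{(k)}^\top$, so padded by zeros if necessary). $\|\cdot\|_F$ is the Frobenius norm. The normalised mode-$k$ tail energy $L_k(r_k)\ge 0$ is defined by $$L_k(r_k)^2=\frac{\sum_{i>r_k}\sigma_i^2(X_{(k)})}{\|\mathcal X\|_F^2},$$ so $L_k(n_k)=0$ and $L_k(n_k-1)^2=\sigma_{n_k}^2(X_{(k)})/\|\mathcal X\|_F^2$. Rank vectors are $\mathbf r=(r_1,\ldots,r_d)\in\mathcal R:=\prod_{k=1}^d\{1,\ldots,n_k\}$.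 The objective (tail-energy surrogate) and the Tucker storage function are $$f(\mathbf r)=\sum_{k=1}^d L_k(r_k)^2,\qquad S(\mathbf r)=\prod_{k=1}^d r_k+\sum_{k=1}^d n_k r_k .$$ Put $$\Delta_k(\mathbf r)=n_k+\prod_{j\ne k}r_j,\qquad s(\mathbf r)=B-S(\mathbf r).$$ An allocation $\mathbf r\in\mathcal R$ with $r_k<n_k$ is called $k$-tight if $0\le s(\mathbf r)<\Delta_k(\mathbf r)$. For a $k$-tight $\mathbf r$ and a mode $m\ne k$ define $$p_{k,m}(\mathbf r)=\left\lceil\frac{\Delta_k(\mathbf r)-s(\mathbf r)}{n_m+(r_k+1)\prod_{j\ne k,m}r_j}\right\rceil,$$ $$c_{k,m}(\mathbf r)=\frac{1}{\|\mathcal X\|_F^2}\sum_{i=r_m-p_{k,m}(\mathbf r)+1}^{r_m}\sigma_i^2(X_{(m)})\quad\text{if }p_{k,m}(\mathbf r)<r_m,$$ and $c_{k,m}(\mathbf r)=\infty$ if $p_{k,m}(\mathbf r)\ge r_m$. Finally $$\Gamma_k(B)=\max_{\substack{\mathbf r\in\mathcal R,\ S(\mathbf r)\le B\\ r_k<n_k,\ 0\le s(\mathbf r)<\Delta_k(\mathbf r)}}\ \min_{m\ne k}c_{k,m}(\mathbf r)\in[0,\infty],$$ with $\Gamma_k(B)=0$ if the maximisation set is empty. *)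

(* Defs.v *)
From mathcomp Require Import all_boot all_order all_algebra.
From mathcomp Require Import polyrcf complex spectral.
From mathcomp Require Import all_classical all_reals all_analysis.

Set Implicit Arguments.
Unset Strict Implicit.
Unset Printing Implicit Defensive.

Import Order.TTheory GRing.Theory Num.Theory.
Local Open Scope ring_scope.

(* The real eigenvalues of A with their algebraic multiplicities, in
   nonincreasing order; for a symmetric A these are all the eigenvalues. *)
Definition real_eigenvalues (R : rcfType) (m : nat) (A : 'M[R]_m) : seq R :=
  sort >=%R
    (flatten [seq nseq (mup x (char_poly A)) x | x <- rootsR (char_poly A)]).

Section RealSpectrum.
Import ComplexField.
Local Open Scope complex_scope.
Local Open Scope sesquilinear_scope.

Fact char_poly_conj (K : fieldType) m (P A : 'M[K]_m) : P \in unitmx ->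
  char_poly (invmx P *m A *m P) = char_poly A.
Proof.
move=> Pu; rewrite /char_poly /char_poly_mx.
have -> : 'X%:M - map_mx polyC (invmx P *m A *m P) =
  map_mx polyC (invmx P) *m ('X%:M - map_mx polyC A) *m map_mx polyC P.
  rewrite mulmxBr mulmxBl !map_mxM; congr (_ - _).
  by rewrite scalar_mxC -mulmxA -map_mxM mulVmx // map_mx1 mulmx1.
rewrite !det_mulmx mulrC mulrA -det_mulmx -map_mxM mulmxV //.
by rewrite map_mx1 det1 mul1r.
Qed.

Lemma real_eigenvalues_char_poly (R : rcfType) (m : nat) (A : 'M[R]_m) :
  A^T = A ->
  char_poly A = \prod_(x <- real_eigenvalues A) ('X - x%:P) /\
  size (real_eigenvalues A) = m.
Proof.
move=> symA; set p := char_poly A.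
have [s ps] : exists s : seq R, p = \prod_(x <- s) ('X - x%:P).
  pose C := R[i]; pose f : {rmorphism R -> C} := real_complex R.
  pose Ac := map_mx f A.
  have fR x : f x \is Num.real by rewrite complex_real.
  have Ah : Ac \is hermsymmx.
    apply: realsym_hermsym.
      apply/is_hermitianmxP; rewrite expr0 scale1r map_mx_id // .
      by rewrite /Ac map_trmx symA.
    by apply/mxOverP => i j; rewrite mxE.
  have Dr := hermitian_spectral_diag_real Ah.
  have /orthomx_spectralP Aeq := hermitian_normalmx Ah.
  set P := spectralmx Ac in Aeq; set D := spectral_diag Ac in Aeq Dr.
  have pc : char_poly Ac = char_poly (diag_mx D).
    by rewrite [in LHS]Aeq char_poly_conj // spectral_unit.
  pose s := [seq complex.Re (D 0 i) | i <- enum 'I_m].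
  exists s; apply: (map_poly_inj f).
  rewrite map_char_poly -/Ac pc rmorph_prod /s big_map big_enum /=.
  rewrite char_poly_trig ?diag_mx_is_trig //; apply: eq_bigr => i _.
  rewrite rmorphB /= map_polyX map_polyC /= mxE eqxx mulr1n RRe_real //.
  by have /mxOverP := Dr; apply.
have p0 : p != 0 by rewrite monic_neq0 // char_poly_monic.
have pe : perm_eq s (real_eigenvalues A).
  rewrite perm_sym /real_eigenvalues -/p perm_sort.
  apply/allP => x _ /=.
  have mu : mup x p = count_mem x s by rewrite ps mu_prod_XsubC.
  rewrite -mu count_flatten -map_comp.
  have un : uniq (rootsR p) by apply: uniq_roots.
  have rt : (x \in rootsR p) = root p x.
    by rewrite -roots_on_rootsR.
  rewrite sumnE big_map.
  case: (boolP (x \in rootsR p)) => xr.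
    rewrite (bigD1_seq x) //= count_nseq /= eqxx mul1n big1 ?addn0 // => y yx.
    by rewrite count_nseq /= (negbTE yx).
  rewrite mupNroot -?rt // big_seq big1 // => y yr.
  rewrite /= count_nseq /=; case: eqP => // yx; by rewrite -yx yr in xr.
have pe' : p = \prod_(x <- real_eigenvalues A) ('X - x%:P).
  by rewrite ps (perm_big _ pe).
split=> //.
by apply/eqP; rewrite -eqSS -(size_char_poly A) -/p pe' size_prod_XsubC.
Qed.
End RealSpectrum.

(* One value per row of A, hence padded by zeros when A has more rows than
   columns. *)
Definition singular_values (R : rcfType) (m p : nat) (A : 'M[R]_(m, p)) :
  seq R := [seq Num.sqrt x | x <- real_eigenvalues (A *m A^T)].

Lemma size_singular_values (R : rcfType) (m p : nat) (A : 'M[R]_(m, p)) :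
  size (singular_values A) = m.
Proof.
rewrite size_map; apply: (proj2 (real_eigenvalues_char_poly _)).
by rewrite trmx_mul trmxK.
Qed.

(* sigma A i is sigma_i(A) with the 1-based indexing sigma_1 >= sigma_2 >= ... ;
   it is only meaningful for 1 <= i <= m. *)
Definition sigma (R : rcfType) (m p : nat) (A : 'M[R]_(m, p)) (i : nat) : R :=
  (singular_values A)`_i.-1.

(* Modes are numbered from 0 to d - 1, and so are the entries along a mode. *)
Definition multi_index (d : nat) (n : 'I_d -> nat) : finType :=
  {dffun forall j : 'I_d, 'I_(n j)}.

Definition tensor (R : realType) (d : nat) (n : 'I_d -> nat) : zmodType :=
  {ffun multi_index n -> R}.

Definition frobenius (R : realType) (d : nat) (n : 'I_d -> nat)
  (X : tensor R n) : R := Num.sqrt (\sum_(t : multi_index n) X t ^+ 2).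

Definition rest_index (d : nat) (n : 'I_d -> nat) (k : 'I_d) : finType :=
  {dffun forall j : {j : 'I_d | j != k}, 'I_(n (val j))}.

Lemma card_rest_index (d : nat) (n : 'I_d -> nat) (k : 'I_d) :
  #|rest_index n k| = (\prod_(j < d | j != k) n j)%N.
Proof.
rewrite card_dep_ffun foldrE big_map big_enum /=.
under eq_bigr do rewrite card_ord.
exact/esym/(big_sub [pred j | j != k]).
Qed.

Definition join_index (d : nat) (n : 'I_d -> nat) (k : 'I_d) (i : 'I_(n k))
    (c : rest_index n k) : multi_index n :=
  [ffun j : 'I_d =>
     match k =P j return 'I_(n j) with
     | ReflectT kj => ecast h 'I_(n h) kj i
     | ReflectF kj => c (exist _ j (introN eqP (fun e => kj (esym e))))
     end].

(* The ordering of the columns is the one of the enumeration of rest_index. *)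
Definition unfolding (R : realType) (d : nat) (n : 'I_d -> nat)
    (X : tensor R n) (k : 'I_d) : 'M[R]_(n k, \prod_(j < d | j != k) n j) :=
  \matrix_(i, c) X (join_index i
    (enum_val (cast_ord (esym (card_rest_index n k)) c))).

Definition tail_energy (R : realType) (d : nat) (n : 'I_d -> nat)
    (X : tensor R n) (k : 'I_d) (rk : nat) : R :=
  Num.sqrt ((\sum_(rk.+1 <= i < (n k).+1) sigma (unfolding X k) i ^+ 2)
            / frobenius X ^+ 2).

(* Rank vectors are the elements r of rank_vectors n; the type rank_type n also
   contains vectors with null entries. *)
Definition rank_type (d : nat) (n : 'I_d -> nat) : finType :=
  {dffun forall j : 'I_d, 'I_(n j).+1}.

Definition rank_vectors (d : nat) (n : 'I_d -> nat) : {set rank_type n} :=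
  [set r : rank_type n | [forall j, (1 <= r j <= n j)%N]].

Definition objective (R : realType) (d : nat) (n : 'I_d -> nat)
  (X : tensor R n) (r : rank_type n) : R :=
  \sum_(k < d) tail_energy X k (r k) ^+ 2.

Definition storage (d : nat) (n : 'I_d -> nat) (r : rank_type n) : nat :=
  (\prod_(k < d) r k + \sum_(k < d) n k * r k)%N.

Definition increment (d : nat) (n : 'I_d -> nat) (k : 'I_d) (r : rank_type n) :
  nat := (n k + \prod_(j < d | j != k) r j)%N.

Definition slack (R : realType) (d : nat) (n : 'I_d -> nat) (B : R)
  (r : rank_type n) : R := B - (storage r)%:R.

Definition feasible (R : realType) (d : nat) (n : 'I_d -> nat) (B : R) :
  {set rank_type n} := [set r in rank_vectors n | (storage r)%:R <= B].

Definition tight (R : realType) (d : nat) (n : 'I_d -> nat) (B : R) (k : 'I_d)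
  (r : rank_type n) : bool :=
  [&& r \in rank_vectors n, (r k < n k)%N
    & 0 <= slack B r < (increment k r)%:R].

(* The ceiling is positive for a tight r, so that the absolute value only
   serves to convert it to a natural number. *)
Definition compensation (R : realType) (d : nat) (n : 'I_d -> nat) (B : R)
    (k m : 'I_d) (r : rank_type n) : nat :=
  absz (Num.ceil
    (((increment k r)%:R - slack B r)
     / (n m + (r k).+1 * \prod_(j < d | (j != k) && (j != m)) r j)%:R)).

Definition cost (R : realType) (d : nat) (n : 'I_d -> nat) (X : tensor R n)
    (B : R) (k m : 'I_d) (r : rank_type n) : \bar R :=
  let p := compensation B k m r in
  if (p < r m)%N then
    ((frobenius X ^+ 2)^-1 *
       \sum_((r m - p).+1 <= i < (r m).+1) sigma (unfolding X m) i ^+ 2)%:E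
  else +oo%E.

(* Costs are nonnegative, so that 0 is neutral for the maximum. *)
Definition Gamma (R : realType) (d : nat) (n : 'I_d -> nat) (X : tensor R n)
    (B : R) (k : 'I_d) : \bar R :=
  \big[maxe/0%E]_(r : rank_type n | (r \in feasible n B) && tight B k r)
     \big[mine/+oo%E]_(m < d | m != k) cost X B k m r.

Definition global_minimiser (R : realType) (d : nat) (n : 'I_d -> nat)
    (X : tensor R n) (B : R) (r : rank_type n) : Prop :=
  r \in feasible n B /\
  forall q : rank_type n, q \in feasible n B -> objective X r <= objective X q.

(* Main.v *)
(** If r* has r*_k < n_k, raise its k-th rank by one.  When the slack covers
the increment this stays feasible; otherwise r* is k-tight, and lowering the
rank of some other mode m by p_{k,m} restores feasibility at an objective cost
c_{k,m}, which for the best m is at most Gamma_k(B).  In both cases the gain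
is sigma_{r*_k + 1}^2 / |X|_F^2 >= L_k(n_k - 1)^2 > Gamma_k(B) >= 0, so the
objective strictly decreases. *)
Require Import Defs.
From mathcomp Require Import all_boot all_order all_algebra.
From mathcomp Require Import all_classical all_reals all_analysis.
From mathcomp Require Import ring lra zify.

Import Order.TTheory GRing.Theory Num.Theory.
Local Open Scope ring_scope.

Lemma sigma_ge0 (R : rcfType) (m p : nat) (A : 'M[R]_(m, p)) (i : nat) :
  0 <= sigma A i.
Proof.
rewrite /sigma; have [lti|gei] := ltnP i.-1 (size (singular_values A)).
  by rewrite (nth_map 0) ?sqrtr_ge0 //; move: lti; rewrite size_map.
by rewrite nth_default.
Qed.

(** The eigenvalue list is sorted and square root is monotone. Beyond the list [sigma] is the
    default 0, and index 0 reads the same entry as index 1. *)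
Lemma sigma_nonincreasing (R : rcfType) (m p : nat) (A : 'M[R]_(m, p))
    (i j : nat) : (i <= j)%N -> sigma A j <= sigma A i.
Proof.
move=> leij; rewrite /sigma.
have [ltj|gej] := ltnP j.-1 (size (singular_values A)); last first.
  by rewrite [leLHS]nth_default //; exact: sigma_ge0.
have leij' : (i.-1 <= j.-1)%N by lia.
move: (ltj) (leq_ltn_trans leij' ltj); rewrite size_map => ltj' lti'.
rewrite !(nth_map 0) // ler_wsqrtr //.
apply: (@sorted_leq_nth _ >=%R) => //.
- by move=> x y z /= xy yz; exact: le_trans yz xy.
- by move=> x; exact: lexx.
- by apply: sort_sorted => x y; exact: le_total.
Qed.

Lemma sqr_tail_energy (R : realType) (d : nat) (n : 'I_d -> nat)
    (X : tensor R n) (k : 'I_d) (a : nat) :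
  tail_energy X k a ^+ 2 =
  (frobenius X ^+ 2)^-1 *
    \sum_(a.+1 <= i < (n k).+1) sigma (unfolding X k) i ^+ 2.
Proof.
rewrite sqr_sqrtr 1?mulrC // mulr_ge0 ?invr_ge0 ?sqr_ge0 //.
by apply: sumr_ge0 => i _; rewrite sqr_ge0.
Qed.

Lemma sqr_tail_energy_cat {R : realType} {d : nat} {n : 'I_d -> nat}
    (X : tensor R n) (k : 'I_d) (a b : nat) : (a <= b <= n k)%N ->
  tail_energy X k a ^+ 2 =
  (frobenius X ^+ 2)^-1 *
    (\sum_(a.+1 <= i < b.+1) sigma (unfolding X k) i ^+ 2)
  + tail_energy X k b ^+ 2.
Proof.
case/andP=> leab leb; rewrite !sqr_tail_energy -mulrDr.
by rewrite -big_cat_nat.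
Qed.

(** With [p = 0] only the rank of mode [k] changes, so one construction serves both cases of the
    proof. [inord] keeps the intended value when [r k < n k]. *)
Definition exchange {d : nat} {n : 'I_d -> nat} (k m : 'I_d) (p : nat)
    (r : rank_type n) : rank_type n :=
  [ffun j : 'I_d =>
     inord (if j == k then (r j).+1 else if j == m then (r j - p)%N else r j)].

Section Exchange.
Context {d : nat} {n : 'I_d -> nat} {k m : 'I_d} {p : nat} {r : rank_type n}.
Hypotheses (rR : r \in rank_vectors n) (rk : (r k < n k)%N).
Hypotheses (mk : m != k) (pr : (p < r m)%N).
Let q := exchange k m p r.

Lemma exchangeE (j : 'I_d) : q j =
  (if j == k then (r j).+1 else if j == m then (r j - p)%N else r j) :> nat.
Proof.
rewrite ffunE inordK // ltnS; case: eqP => [->//|_].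
case: ifP => _; last exact: leq_ord.
exact: leq_trans (leq_subr _ _) (leq_ord _).
Qed.

Lemma exchange_raised : q k = (r k).+1 :> nat.
Proof. by rewrite exchangeE eqxx. Qed.

Lemma exchange_lowered : q m = (r m - p)%N :> nat.
Proof. by rewrite exchangeE (negbTE mk) eqxx. Qed.

Lemma exchange_other (j : 'I_d) : (j != k) && (j != m) -> q j = r j :> nat.
Proof. by rewrite exchangeE => /andP[/negbTE-> /negbTE->]. Qed.

Lemma exchange_rank_vectors : q \in rank_vectors n.
Proof.
rewrite inE; apply/forallP => j; rewrite leq_ord andbT exchangeE.
move: rR; rewrite inE => /forallP/(_ j)/andP[r1 _].
by case: eqP => // _; case: eqP => [->|//]; rewrite subn_gt0.
Qed.

(** Storage is affine in each rank. Raising mode [k] costs [increment k r]; from then on each unit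
    of rank in mode [m] weighs the denominator of [compensation]. *)
Lemma storage_exchange :
  (storage q + p * (n m + (r k).+1 * \prod_(j < d | (j != k) && (j != m)) r j)
   = storage r + increment k r)%N.
Proof.
have prod_but_k (v : rank_type n) : (\prod_(j < d | j != k) v j =
    v m * \prod_(j < d | (j != k) && (j != m)) v j)%N by exact: bigD1.
have prod_all (v : rank_type n) :
    (\prod_(j < d) v j = v k * \prod_(j < d | j != k) v j)%N by exact: bigD1.
have sum_all (v : rank_type n) : (\sum_(j < d) n j * v j = n k * v k +
    (n m * v m + \sum_(j < d | (j != k) && (j != m)) n j * v j))%N.
  by rewrite (bigD1 k) //= (bigD1 m).
have sum_rest : (\sum_(j < d | (j != k) && (j != m)) n j * q j =
    \sum_(j < d | (j != k) && (j != m)) n j * r j)%N.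
  by apply: eq_bigr => j /exchange_other->.
rewrite /storage /increment !prod_all !prod_but_k !sum_all.
rewrite exchange_raised exchange_lowered.
rewrite sum_rest (eq_bigr _ exchange_other).
(* Writing [r m] as [a + p] removes the truncated subtraction, leaving a semiring identity. *)
have := subnK (ltnW pr); move: (r m - p)%N => a <-.
set P := (\prod_(_ < _ | _) _)%N; set S := (\sum_(_ < _ | _) _)%N.
ring.
Qed.

(** The objective is separable over modes: only the tails of [k] and [m] move, each by the squared
    singular values that its rank crosses. *)
Lemma objective_exchange {R : realType} (X : tensor R n) :
  objective X q + (frobenius X ^+ 2)^-1 * sigma (unfolding X k) (r k).+1 ^+ 2
  = objective X r + (frobenius X ^+ 2)^-1 *
      \sum_((r m - p).+1 <= i < (r m).+1) sigma (unfolding X m) i ^+ 2.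
Proof.
have split2 (v : rank_type n) : objective X v =
    tail_energy X k (v k) ^+ 2 + (tail_energy X m (v m) ^+ 2 +
      \sum_(j < d | (j != k) && (j != m)) tail_energy X j (v j) ^+ 2).
  by rewrite /objective (bigD1 k) //= (bigD1 m).
have sum_rest :
    \sum_(j < d | (j != k) && (j != m)) tail_energy X j (q j) ^+ 2 =
    \sum_(j < d | (j != k) && (j != m)) tail_energy X j (r j) ^+ 2.
  by apply: eq_bigr => j /exchange_other->.
rewrite !split2 sum_rest exchange_raised exchange_lowered.
rewrite (sqr_tail_energy_cat X k (r k) (r k).+1) ?leqnSn //.
rewrite (sqr_tail_energy_cat X m (r m - p) (r m)); last first.
  by rewrite leq_subr leq_ord.
rewrite big_nat1; ring.
Qed.

End Exchange.
(** The tail past [(n k).-1] is the single smallest singular value of mode [k], hence a lower bound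
    on the gain that does not depend on [r k]. *)
Lemma exchange_decreases (R : realType) (d : nat) (n : 'I_d -> nat)
    (X : tensor R n) (k m : 'I_d) (p : nat) (r : rank_type n) :
  (r k < n k)%N -> m != k -> (p < r m)%N ->
  (frobenius X ^+ 2)^-1 *
    (\sum_((r m - p).+1 <= i < (r m).+1) sigma (unfolding X m) i ^+ 2)
    < tail_energy X k (n k).-1 ^+ 2 ->
  objective X (exchange k m p r) < objective X r.
Proof.
move=> rk mk pr; rewrite sqr_tail_energy prednK ?(leq_trans _ rk) //.
rewrite big_nat1 => cost_lt.
have := objective_exchange (p := p) rk mk X.
have : (frobenius X ^+ 2)^-1 * sigma (unfolding X k) (n k) ^+ 2
       <= (frobenius X ^+ 2)^-1 * sigma (unfolding X k) (r k).+1 ^+ 2.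
  rewrite ler_wpM2l ?invr_ge0 ?sqr_ge0 // ler_sqr ?nnegrE ?sigma_ge0 //.
  exact: sigma_nonincreasing.
lra.
Qed.

Lemma exchange_feasible {R : realType} {d : nat} {n : 'I_d -> nat} {B : R}
    {k m : 'I_d} {p : nat} {r : rank_type n} :
  r \in rank_vectors n -> (r k < n k)%N -> m != k -> (p < r m)%N ->
  (increment k r)%:R - slack B r <= p%:R *
    (n m + (r k).+1 * \prod_(j < d | (j != k) && (j != m)) r j)%:R ->
  exchange k m p r \in feasible n B.
Proof.
move=> rR rk mk pr; have := storage_exchange rk mk pr.
set D := (n m + _)%N => /(congr1 (fun a : nat => a%:R : R)).
(* The factor in the bound is convertible to [D]; refolding it gives [lra] a common atom. *)
rewrite -[X in _ <= _ * X]/(D%:R) natrD natrM natrD /slack.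
rewrite inE exchange_rank_vectors //=; lra.
Qed.

(** Rounding the quotient up covers the storage deficit, as the denominator is positive by
    [1 <= r m <= n m]. *)
Lemma compensation_bound (R : realType) (d : nat) (n : 'I_d -> nat) (B : R)
    (k m : 'I_d) (r : rank_type n) : tight B k r ->
  (increment k r)%:R - slack B r <= (compensation B k m r)%:R *
    (n m + (r k).+1 * \prod_(j < d | (j != k) && (j != m)) r j)%:R.
Proof.
case/and3P=> rR _ /andP[_ slack_lt].
rewrite /compensation; set N := _ - slack B r; set D : R := (n m + _)%:R.
have D_gt0 : 0 < D.
  rewrite ltr0n; move: rR; rewrite inE => /forallP/(_ m)/andP[r1 rn].
  exact: leq_trans (leq_trans r1 rn) (leq_addr _ _).
rewrite -ler_pdivrMr // natr_absz ger0_norm ?ceil_ge //.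
by rewrite -(ler_int R) (le_trans _ (ceil_ge _)) // divr_ge0 ?ltW ?subr_gt0.
Qed.

Theorem theorem5p1 (R : realType) (d : nat) (n : 'I_d -> nat)
    (X : tensor R n) (B : R) (k : 'I_d)
    (d_ge2 : (2 <= d)%N) (X_neq0 : X != 0)
    (feasible_neq0 : exists q : rank_type n, q \in feasible n B)
    (nk_ge2 : (2 <= n k)%N) :
  ((Gamma X B k < (tail_energy X k (n k).-1 ^+ 2)%:E)%E ->
     forall r : rank_type n,
       global_minimiser X B r -> nat_of_ord (r k) = n k) /\
  (Gamma X B k = +oo%E ->
     ~ (Gamma X B k < (tail_energy X k (n k).-1 ^+ 2)%:E)%E).
Proof.
split=> [Gamma_lt r [rF rmin]|->]; last by rewrite ltNge leey.
have := rF; rewrite inE => /andP[rR rB].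
have := leq_ord (r k); rewrite leq_eqVlt => /predU1P[//|rk]; exfalso.
(* Both cases reduce to finding a mode [m] and an amount [p] that restore feasibility at a cost
   below the gain. *)
suff [m [p [mk pr cover cost_lt]]] : exists m p, [/\ m != k, (p < r m)%N,
    (increment k r)%:R - slack B r <= p%:R *
      (n m + (r k).+1 * \prod_(j < d | (j != k) && (j != m)) r j)%:R
  & (frobenius X ^+ 2)^-1 *
      (\sum_((r m - p).+1 <= i < (r m).+1) sigma (unfolding X m) i ^+ 2)
      < tail_energy X k (n k).-1 ^+ 2].
  have := rmin _ (exchange_feasible rR rk mk pr cover).
  by rewrite leNgt exchange_decreases.
have [rtight|rloose] := boolP (tight B k r).
  have : (\big[mine/+oo]_(m < d | m != k) cost X B k m r
          < (tail_energy X k (n k).-1 ^+ 2)%:E)%E.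
    apply: le_lt_trans Gamma_lt.
    by apply: (@le_bigmax_cond _ _ _ 0%E r); rewrite rF.
  case/bigmin_ltP=> [|[m mk]]; first by rewrite ltNge leey.
  (* A cost below a real number is not [+oo], which forces [p < r m]. *)
  rewrite /cost; case: ifPn => [pr|_]; last by rewrite ltNge leey.
  rewrite lte_fin => cost_lt; exists m, (compensation B k m r); split=> //.
  exact: compensation_bound.
(* When the slack suffices, any second mode will do, since it gives up [p = 0] ranks; one exists by
   [2 <= d]. *)
have [m mk] : exists m : 'I_d, m != k.
  have /card_gt0P[m] : (0 < #|[pred m | m != k]|)%N.
    by rewrite (cardC1 k) card_ord -ltnS prednK // ltnW.
  by exists m.
exists m, 0%N; split=> //.
- by move: rR; rewrite inE => /forallP/(_ m)/andP[].
- rewrite mul0r subr_le0 leNgt; apply: contra rloose => slack_lt.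
  by rewrite /tight rR rk slack_lt subr_ge0 rB.
(* The cost is an empty sum, and [Gamma] is at least 0, the initial value of its maximum. *)
- rewrite subn0 big_geq // mulr0 -lte_fin; apply: le_lt_trans Gamma_lt.
  by apply/bigmax_geP; left.
Qed.
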